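(* Let $\mathcal{C}$ be a pointed finitely complete category. For each point $(\alpha\colon A\to B,\beta\colon B\to A)$ in $\mathcal{C}$, with $\kappa\colon X\to A$ a kernel of $\alpha$, consider the functor $$F\colon \mathsf{Sub}_{\mathsf{Pt}_B(\mathcal{C})}(\alpha,\beta)\to \mathsf{Sub}_{\mathcal{C}}(X)$$ induced by the kernel functor $\mathrm{Ker}\colon \mathsf{Pt}_B(\mathcal{C})\to\mathcal{C}$, sending a subobject of $(\alpha,\beta)$ to its restriction to kernels. If $\mathcal{C}$ has split extension cores, then for each point $(\alpha,\beta)$ in $\mathcal{C}$ this functor $F$ has a right adjoint. The converse is true as soon as $\mathcal{C}$ is regular: if $\mathcal{C}$ is regular and for each point $(\alpha,\beta)$ the functor $F$ has a right adjoint, then $\mathcal{C}$ has split extension cores.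
   Context: For an object $B$ of $\mathcal{C}$, $\mathsf{Pt}_B(\mathcal{C})$ is the category of points over $B$: objects are pairs $(\alpha\colon A\to B,\ \beta\colon B\to A)$ with $\alpha\circ\beta=1_B$; a morphism $(\alpha,\beta)\to(\bar\alpha\colon\bar A\to B,\bar\beta\colon B\to\bar A)$ is an arrow $f\colon A\to\bar A$ with $\bar\alpha\circ f=\alpha$ and $f\circ\beta=\bar\beta$. The kernel functor sends $(\alpha,\beta)$ to the kernel object of $\alpha$. For a category $\mathcal{D}$ and an object $D$, $\mathsf{Sub}_{\mathcal{D}}(D)$ denotes the ordered class of subobjects of $D$ in $\mathcal{D}$, regarded as a category. In a pointed category with finite limits, a split extension $(\alpha,\beta,\kappa)$ of $B$ by $X$ consists of $\alpha\colon A\to B$, $\beta\colon B\to A$ with $\alpha\circ\beta=1_B$ and $\kappa\colon X\to A$ a kernel of $\alpha$. Given such a split extension and a monomorphism $s\colon S\to X$, a lifting consists of a split extension $(\bar\alpha\colon\bar A\to B,\bar\beta,\bar\kappa\colon\bar X\to\bar A)$ over the same $B$ and morphisms $u\colon\bar X\to S$, $v\colon\bar A\to A$ with $v\circ\bar\kappa=\kappa\circ s\circ u$, $\alpha\circ v=\bar\alpha$, $v\circ\bar\beta=\beta$. A split extension core of $s$ relative to $(\alpha,\beta,\kappa)$ is a terminal such lifting (morphisms of liftings being morphisms of split extensions, identical on $B$, compatible with the $u$'s and $v$'s). $\mathcal{C}$ has split extension cores when a split extension core exists for each split extension $(\alpha,\beta,\kappa)$ and each subobject $S\leq X$ of the domain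 $X$ of $\kappa$. *)

(* Defs.v *)
From Stdlib Require Import ssreflect List ProofIrrelevance IndefiniteDescription.

Set Implicit Arguments.
Unset Strict Implicit.
Unset Printing Implicit Defensive.

Record category : Type := Category {
  Ob :> Type;
  Hom : Ob -> Ob -> Type;
  idm : forall a, Hom a a;
  comp : forall a b c, Hom b c -> Hom a b -> Hom a c;
  comp_idl : forall a b (f : Hom a b), comp (idm b) f = f;
  comp_idr : forall a b (f : Hom a b), comp f (idm a) = f;
  compA : forall a b c d (h : Hom c d) (g : Hom b c) (f : Hom a b),
    comp h (comp g f) = comp (comp h g) f
}.
Arguments Hom {c} a b : rename.
Arguments idm {c} a : rename.
Arguments comp {c a b c0} _ _ : rename.
Arguments comp_idl {c a b} f : rename.
Arguments comp_idr {c a b} f : rename.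
Arguments compA {c a b c0 d} h g f : rename.

Declare Scope cat_scope.
Delimit Scope cat_scope with cat.
Open Scope cat_scope.
Notation "g ∘ f" := (comp g f) (at level 40, left associativity) : cat_scope.

Record functor (C D : category) : Type := Functor {
  fob :> C -> D;
  fmap : forall a b : C, Hom a b -> Hom (fob a) (fob b);
  fmap_id : forall a, fmap (idm a) = idm (fob a);
  fmap_comp : forall (a b c : C) (g : Hom b c) (f : Hom a b),
    fmap (g ∘ f) = fmap g ∘ fmap f
}.
Arguments fmap {C D} f {a b} _ : rename.

Record adjunction (C D : category) (F : functor C D) (G : functor D C) : Type :=
  Adjunction {
  adj_to : forall (x : C) (y : D), Hom (F x) y -> Hom x (G y);
  adj_from : forall (x : C) (y : D), Hom x (G y) -> Hom (F x) y;
  adj_toK : forall x y (f : Hom (F x) y), adj_from (adj_to f) = f;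
  adj_fromK : forall x y (g : Hom x (G y)), adj_to (adj_from g) = g;
  adj_natl : forall (x x' : C) (y : D) (a : Hom x' x) (f : Hom (F x) y),
    adj_to (f ∘ fmap F a) = adj_to f ∘ a;
  adj_natr : forall (x : C) (y y' : D) (b : Hom y y') (f : Hom (F x) y),
    adj_to (b ∘ f) = fmap G b ∘ adj_to f
}.

Definition has_right_adjoint (C D : category) (F : functor C D) : Prop :=
  exists G : functor D C, inhabited (adjunction F G).

Definition preorder_category (T : Type) (R : T -> T -> Prop)
    (Rrefl : forall x, R x x)
    (Rtrans : forall x y z, R y z -> R x y -> R x z) : category :=
  @Category T R Rrefl Rtrans
    (fun _ _ _ => proof_irrelevance _ _ _)
    (fun _ _ _ => proof_irrelevance _ _ _)
    (fun _ _ _ _ _ _ _ => proof_irrelevance _ _ _).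

Section Universal.
Variable C : category.

Definition is_mono (a b : C) (m : Hom a b) : Prop :=
  forall (z : C) (g h : Hom z a), m ∘ g = m ∘ h -> g = h.

Definition is_initial (a : C) : Prop :=
  forall b : C, exists f : Hom a b, forall g : Hom a b, g = f.

Definition is_terminal (a : C) : Prop :=
  forall b : C, exists f : Hom b a, forall g : Hom b a, g = f.

Definition is_zero_object (z : C) : Prop := is_initial z /\ is_terminal z.

Definition pointed : Prop := exists z : C, is_zero_object z.

Definition is_zero_arrow (a b : C) (f : Hom a b) : Prop :=
  exists z : C, is_zero_object z /\
    exists (h : Hom z b) (g : Hom a z), f = h ∘ g.

Definition is_kernel (k a b : C) (i : Hom k a) (f : Hom a b) : Prop :=
  is_zero_arrow (f ∘ i) /\
  forall (z : C) (h : Hom z a), is_zero_arrow (f ∘ h) ->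
    exists! l : Hom z k, i ∘ l = h.

(* [p, q] is the pullback of the cospan [f, g]. *)
Definition is_pullback (a b c : C) (f : Hom a c) (g : Hom b c)
    (e : C) (p : Hom e a) (q : Hom e b) : Prop :=
  f ∘ p = g ∘ q /\
  forall (z : C) (x : Hom z a) (y : Hom z b), f ∘ x = g ∘ y ->
    exists! l : Hom z e, p ∘ l = x /\ q ∘ l = y.

Definition is_coequalizer (a b c : C) (f g : Hom a b) (q : Hom b c) : Prop :=
  q ∘ f = q ∘ g /\
  forall (z : C) (h : Hom b z), h ∘ f = h ∘ g -> exists! l : Hom c z, l ∘ q = h.

Definition is_regular_epi (b c : C) (q : Hom b c) : Prop :=
  exists (a : C) (f g : Hom a b), is_coequalizer f g q.

Record cone (J : category) (D : functor J C) : Type := Cone {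
  apex : C;
  leg : forall j, Hom apex (D j);
  leg_nat : forall (i j : J) (f : Hom i j), fmap D f ∘ leg i = leg j
}.

Definition is_limit (J : category) (D : functor J C) (K : cone D) : Prop :=
  forall L : cone D, exists! l : Hom (apex L) (apex K),
    forall j, leg K j ∘ l = leg L j.

Definition finite_category (J : category) : Prop :=
  (exists s : list J, forall x, In x s) /\
  (forall x y : J, exists s : list (Hom x y), forall f, In f s).

Definition finitely_complete : Prop :=
  forall J : category, finite_category J ->
    forall D : functor J C, exists K : cone D, is_limit K.

Definition regular : Prop :=
  finitely_complete /\
  (forall (a b e : C) (f : Hom a b) (p q : Hom e a), is_pullback f f p q ->
     exists (c : C) (r : Hom a c), is_coequalizer p q r) /\
  (forall (a b c e : C) (f : Hom a c) (g : Hom b c)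
     (p : Hom e a) (q : Hom e b),
     is_pullback f g p q -> is_regular_epi f -> is_regular_epi q).

End Universal.

Inductive cospan_ob : Set := cospan_l | cospan_r | cospan_c.

Definition cospan_hom (x y : cospan_ob) : Set :=
  match x, y with
  | cospan_l, cospan_l | cospan_r, cospan_r | _, cospan_c => unit
  | _, _ => Empty_set
  end.

Definition cospan_id (x : cospan_ob) : cospan_hom x x :=
  match x with cospan_l | cospan_r | cospan_c => tt end.

Definition cospan_comp (x y z : cospan_ob) :
  cospan_hom y z -> cospan_hom x y -> cospan_hom x z.
Proof.
by case: x y z; case; case=> /= g f; solve [exact: tt | case: g | case: f].
Defined.

Lemma cospan_hom_unique (x y : cospan_ob) (f g : cospan_hom x y) : f = g.
Proof. by case: x y f g; case=> /= [] [] []. Qed.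

Definition cospan_category : category :=
  @Category cospan_ob cospan_hom cospan_id cospan_comp
    (fun _ _ _ => cospan_hom_unique _ _) (fun _ _ _ => cospan_hom_unique _ _)
    (fun _ _ _ _ _ _ _ => cospan_hom_unique _ _).

Lemma cospan_finite : finite_category cospan_category.
Proof.
split; first by exists (cospan_l :: cospan_r :: cospan_c :: nil); case=> /=; tauto.
by case; case; (try by exists nil; case); exists (tt :: nil); case; left.
Qed.


Section CospanFunctor.
Variables (C : category) (a b c : C) (f : Hom a c) (g : Hom b c).

Definition cospan_fob (x : cospan_category) : C :=
  match x with cospan_l => a | cospan_r => b | cospan_c => c end.

Definition cospan_fmap (x y : cospan_category) :
  Hom x y -> Hom (cospan_fob x) (cospan_fob y) :=
  match x, y return cospan_hom x y -> Hom (cospan_fob x) (cospan_fob y) with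
  | cospan_l, cospan_l => fun _ => idm a
  | cospan_r, cospan_r => fun _ => idm b
  | cospan_c, cospan_c => fun _ => idm c
  | cospan_l, cospan_c => fun _ => f
  | cospan_r, cospan_c => fun _ => g
  | _, _ => Empty_set_rect _
  end.

Definition cospan_functor : functor cospan_category C.
Proof.
refine (@Functor _ _ cospan_fob cospan_fmap _ _); first by case.
by case; case; case=> //= [] [] [] /=; rewrite ?comp_idl ?comp_idr.
Defined.

Definition cospan_cone (e : C) (p : Hom e a) (q : Hom e b) (E : f ∘ p = g ∘ q) :
  cone cospan_functor.
Proof.
refine (@Cone _ _ cospan_functor e
  (fun x => match x return Hom e (cospan_fob x) with
            | cospan_l => p | cospan_r => q | cospan_c => f ∘ p end) _).
by case; case=> //= _; rewrite ?comp_idl.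
Defined.

End CospanFunctor.

Lemma pullback_exists (C : category) (hl : finitely_complete C)
    (a b c : C) (f : Hom a c) (g : Hom b c) :
  exists (e : C) (p : Hom e a) (q : Hom e b), is_pullback f g p q.
Proof.
case: (hl _ cospan_finite (cospan_functor f g)) => K HK.
have El : f ∘ leg K cospan_l = leg K cospan_c
  := @leg_nat _ _ _ K cospan_l cospan_c tt.
have Er : g ∘ leg K cospan_r = leg K cospan_c
  := @leg_nat _ _ _ K cospan_r cospan_c tt.
exists (apex K), (leg K cospan_l), (leg K cospan_r); split; first by rewrite El Er.
move=> z x y E; case: (HK (cospan_cone E)) => l [/= Hl Ul].
exists l; split; first by split; [exact: (Hl cospan_l) | exact: (Hl cospan_r)].
move=> l' [H1 H2]; apply: Ul; case; [exact: H1 | exact: H2 |].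
by rewrite -El -compA; congr (_ ∘ _).
Qed.

Section Kernels.
Variables (C : category) (hz : pointed C) (hl : finitely_complete C).

Lemma zero_arrow_compl (a b c : C) (g : Hom b c) (f : Hom a b) :
  is_zero_arrow f -> is_zero_arrow (g ∘ f).
Proof.
by case=> z [Hz [h [k ->]]]; exists z; split=> //; exists (g ∘ h), k; rewrite compA.
Qed.

Lemma zero_arrow_compr (a b c : C) (g : Hom b c) (f : Hom a b) :
  is_zero_arrow g -> is_zero_arrow (g ∘ f).
Proof.
by case=> z [Hz [h [k ->]]]; exists z; split=> //; exists h, (k ∘ f); rewrite compA.
Qed.

Record kernel (a b : C) (f : Hom a b) : Type := Kernel {
  ker_ob : C;
  ker_arr : Hom ker_ob a;
  ker_is_kernel : is_kernel ker_arr f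
}.

Lemma kernel_exists (a b : C) (f : Hom a b) : exists _ : kernel f, True.
Proof.
case: hz => z Hz; case: (proj1 Hz b) => o _.
case: (pullback_exists hl f o) => e [p [q [E U]]].
suff K : is_kernel p f by exists (Kernel K).
split; first by rewrite E; exists z; split=> //; exists o, q.
move=> y h [z' [Hz' [k [g Eh]]]].
case: (proj1 Hz' z) => t _.
have Et : k = o ∘ t by case: (proj1 Hz' b) => w Hw; rewrite (Hw k) (Hw (o ∘ t)).
have Eh' : f ∘ h = o ∘ (t ∘ g) by rewrite compA -Et.
case: (U _ _ _ Eh') => l [[H1 H2] Ul]; exists l; split=> // l' H'.
apply: Ul; split=> //.
by case: (proj2 Hz y) => w Hw; rewrite (Hw (q ∘ l')) (Hw (t ∘ g)).
Qed.

Definition chosen_kernel (a b : C) (f : Hom a b) : kernel f :=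
  proj1_sig (constructive_indefinite_description _ (kernel_exists f)).

Definition ker_lift (k a b : C) (i : Hom k a) (f : Hom a b) (hk : is_kernel i f)
    (z : C) (h : Hom z a) (hh : is_zero_arrow (f ∘ h)) : Hom z k :=
  proj1_sig (constructive_indefinite_description _ (proj2 hk z h hh)).

Lemma ker_liftE (k a b : C) (i : Hom k a) (f : Hom a b) (hk : is_kernel i f)
    (z : C) (h : Hom z a) (hh : is_zero_arrow (f ∘ h)) :
  i ∘ ker_lift hk hh = h.
Proof.
rewrite /ker_lift.
by case: constructive_indefinite_description => l /= [].
Qed.

Lemma kernel_mono (k a b : C) (i : Hom k a) (f : Hom a b) :
  is_kernel i f -> is_mono i.
Proof.
case=> Hz U z g h E.
have Hg : is_zero_arrow (f ∘ (i ∘ g)) by rewrite compA; apply: zero_arrow_compr.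
case: (U _ _ Hg) => l [_ Ul].
by rewrite -(Ul g) // (Ul h).
Qed.

End Kernels.

(* A subobject is an equivalence class of monomorphisms, encoded as a set of
   monomorphisms; the subobjects of [d] form a thin category under [sub_le]. *)
Section Subobjects.
Variable C : category.

Record mono_into (d : C) : Type := MonoInto {
  mono_dom : C;
  mono_arr : Hom mono_dom d;
  mono_is_mono : is_mono mono_arr
}.

Definition mono_le (d : C) (m n : mono_into d) : Prop :=
  exists t : Hom (mono_dom m) (mono_dom n), mono_arr n ∘ t = mono_arr m.

Definition mono_equiv (d : C) (m n : mono_into d) : Prop :=
  mono_le m n /\ mono_le n m.

Record subobject (d : C) : Type := Subobject {
  sub_rep : mono_into d -> Prop;
  sub_is_class : exists m, forall n, sub_rep n <-> mono_equiv m n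
}.

Definition sub_le (d : C) (S T : subobject d) : Prop :=
  forall m n, sub_rep S m -> sub_rep T n -> mono_le m n.

Lemma mono_le_refl (d : C) (m : mono_into d) : mono_le m m.
Proof. by exists (idm _); rewrite comp_idr. Qed.

Lemma mono_le_trans (d : C) (m n p : mono_into d) :
  mono_le m n -> mono_le n p -> mono_le m p.
Proof. by move=> [t Et] [s Es]; exists (s ∘ t); rewrite compA Es. Qed.

Lemma sub_rep_equiv (d : C) (S : subobject d) m n :
  sub_rep S m -> sub_rep S n <-> mono_equiv m n.
Proof.
case: S => R [m0 Hm] /= /Hm [H1 H2]; rewrite Hm; split=> [] [H3 H4]; split;
  by [apply: (mono_le_trans H1) | apply: (mono_le_trans H2)
     | apply: (mono_le_trans H3) | apply: (mono_le_trans H4)].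
Qed.

Lemma sub_le_refl (d : C) (S : subobject d) : sub_le S S.
Proof. by move=> m n Hm /(sub_rep_equiv _ Hm) []. Qed.

Lemma sub_le_trans (d : C) (S T U : subobject d) :
  sub_le T U -> sub_le S T -> sub_le S U.
Proof.
move=> HTU HST m n Hm Hn; case: (sub_is_class T) => p Hp.
have Tp : sub_rep T p by apply/Hp; split; apply: mono_le_refl.
by apply: (@mono_le_trans _ _ p); [apply: HST | apply: HTU].
Qed.

Definition Sub (d : C) : category :=
  preorder_category (@sub_le_refl d) (@sub_le_trans d).

End Subobjects.

(* For [K] preserving monomorphisms and a monomorphism [i : K d -> x], the
   functor between subobjects sending the class of [m] to that of [i ∘ K m]. *)
Section InducedSub.
Variables (D C : category) (K : functor D C).
Hypothesis K_mono : forall (a b : D) (f : Hom a b), is_mono f -> is_mono (fmap K f).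
Variables (d : D) (x : C) (i : Hom (K d) x).
Hypothesis i_mono : is_mono i.

Lemma induced_is_mono (m : mono_into d) : is_mono (i ∘ fmap K (mono_arr m)).
Proof.
move=> z g h; rewrite -!compA => /i_mono; apply: K_mono; exact: mono_is_mono.
Qed.

Definition induced_mono (m : mono_into d) : mono_into x :=
  MonoInto (@induced_is_mono m).

Lemma induced_mono_le (m n : mono_into d) :
  mono_le m n -> mono_le (induced_mono m) (induced_mono n).
Proof.
by move=> [t Et]; exists (fmap K t); rewrite /= -compA -fmap_comp Et.
Qed.

Definition induced_rep (S : subobject d) (n : mono_into x) : Prop :=
  exists m, sub_rep S m /\ mono_equiv (induced_mono m) n.

Lemma induced_is_class (S : subobject d) :
  exists m, forall n, induced_rep S n <-> mono_equiv m n.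
Proof.
case: (sub_is_class S) => m Hm.
have Sm : sub_rep S m by apply/Hm; split; apply: mono_le_refl.
exists (induced_mono m) => n; split; last by exists m.
move=> [m' [/Hm [H1 H2] [H3 H4]]].
by split; [apply: mono_le_trans H3 | apply: (mono_le_trans H4)];
  apply: induced_mono_le.
Qed.

Definition induced_sub_ob (S : subobject d) : subobject x :=
  Subobject (induced_is_class S).

Lemma induced_sub_le (S T : subobject d) :
  sub_le S T -> sub_le (induced_sub_ob S) (induced_sub_ob T).
Proof.
move=> H n n' [m [Hm [_ E]]] [m' [Hm' [E' _]]].
apply: (mono_le_trans E); apply: mono_le_trans E'.
by apply: induced_mono_le; apply: H.
Qed.

Definition induced_sub : functor (Sub d) (Sub x) :=
  @Functor (Sub d) (Sub x) induced_sub_ob induced_sub_le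
    (fun _ => proof_irrelevance (sub_le _ _) _ _)
    (fun _ _ _ _ _ => proof_irrelevance (sub_le _ _) _ _).

End InducedSub.

Section Points.
Variable C : category.

Record point (b : C) : Type := Point {
  pt_ob : C;
  pt_ret : Hom pt_ob b;
  pt_sec : Hom b pt_ob;
  pt_eq : pt_ret ∘ pt_sec = idm b
}.

Record point_hom (b : C) (p q : point b) : Type := PointHom {
  ph_arr : Hom (pt_ob p) (pt_ob q);
  ph_ret : pt_ret q ∘ ph_arr = pt_ret p;
  ph_sec : ph_arr ∘ pt_sec p = pt_sec q
}.

Lemma point_hom_ext (b : C) (p q : point b) (f g : point_hom p q) :
  ph_arr f = ph_arr g -> f = g.
Proof.
case: f g => f H1 H2 [g H3 H4] /= E; subst g.
by rewrite (proof_irrelevance _ H1 H3) (proof_irrelevance _ H2 H4).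
Qed.

Definition point_id (b : C) (p : point b) : point_hom p p :=
  PointHom (comp_idr (pt_ret p)) (comp_idl (pt_sec p)).

Definition point_comp (b : C) (p q r : point b) (g : point_hom q r)
    (f : point_hom p q) : point_hom p r.
Proof.
refine (@PointHom b p r (ph_arr g ∘ ph_arr f) _ _).
- by rewrite compA !ph_ret.
- by rewrite -compA !ph_sec.
Defined.

Definition Pt (b : C) : category.
Proof.
refine (@Category (point b) (@point_hom b) (@point_id b) (@point_comp b) _ _ _);
  move=> *; apply: point_hom_ext => /=.
- exact: comp_idl.
- exact: comp_idr.
- exact: compA.
Defined.

End Points.

Section KernelFunctor.
Variables (C : category) (hz : pointed C) (hl : finitely_complete C) (b : C).

Definition Ker_ob (p : Pt b) : C := ker_ob (chosen_kernel hz hl (pt_ret p)).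

Definition ker_incl (p : Pt b) : Hom (Ker_ob p) (pt_ob p) :=
  ker_arr (chosen_kernel hz hl (pt_ret p)).

Lemma ker_incl_is_kernel (p : Pt b) : is_kernel (ker_incl p) (pt_ret p).
Proof. exact: ker_is_kernel. Qed.

Lemma Ker_zero (p q : Pt b) (f : Hom p q) :
  is_zero_arrow (pt_ret q ∘ (ph_arr f ∘ ker_incl p)).
Proof. by rewrite compA ph_ret; apply: (proj1 (ker_incl_is_kernel p)). Qed.

Definition Ker_fmap (p q : Pt b) (f : Hom p q) : Hom (Ker_ob p) (Ker_ob q) :=
  ker_lift (ker_incl_is_kernel q) (Ker_zero f).

Lemma Ker_fmapE (p q : Pt b) (f : Hom p q) :
  ker_incl q ∘ Ker_fmap f = ph_arr f ∘ ker_incl p.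
Proof. exact: ker_liftE. Qed.

Definition Ker : functor (Pt b) C.
Proof.
refine (@Functor (Pt b) C Ker_ob Ker_fmap _ _).
- move=> p; apply: (kernel_mono (ker_incl_is_kernel p)).
  by rewrite Ker_fmapE comp_idl comp_idr.
- move=> p q r g f; apply: (kernel_mono (ker_incl_is_kernel r)).
  by rewrite Ker_fmapE compA Ker_fmapE -compA Ker_fmapE compA.
Defined.

Lemma point_mono (p q : Pt b) (f : Hom p q) : is_mono f -> is_mono (ph_arr f).
Proof.
move=> Hf z g h E.
case: (pullback_exists hl (ph_arr f) (ph_arr f)) => e [p1 [p2 [E12 U]]].
have Es : ph_arr f ∘ pt_sec p = ph_arr f ∘ pt_sec p by [].
case: (U _ _ _ Es) => s [[s1 s2] _].
have Hs : pt_ret p ∘ p1 ∘ s = idm b by rewrite -compA s1 pt_eq.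
pose P : Pt b := Point Hs.
have R2 : pt_ret p ∘ p2 = pt_ret p ∘ p1.
  by rewrite -(ph_ret f) -!compA E12.
pose P1 : @Hom (Pt b) P p := @PointHom C b P p p1 (eq_refl _) s1.
pose P2 : @Hom (Pt b) P p := @PointHom C b P p p2 R2 s2.
have E' : P1 = P2 by apply: Hf; apply: point_hom_ext.
have {}E' : p1 = p2 := f_equal (@ph_arr C b P p) E'.
by case: (U _ _ _ E) => l [[<- <-] _]; rewrite E'.
Qed.

Lemma Ker_mono (p q : Pt b) (f : Hom p q) : is_mono f -> is_mono (fmap Ker f).
Proof.
move=> /point_mono Hf z g h E.
apply: (kernel_mono (ker_incl_is_kernel p)); apply: Hf.
by rewrite !compA -!Ker_fmapE -!compA; congr (_ ∘ _).
Qed.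

(* The canonical isomorphism from the chosen kernel to a given one. *)
Definition ker_comparison (p : Pt b) (x : C) (k : Hom x (pt_ob p))
    (hk : is_kernel k (pt_ret p)) : Hom (Ker p) x :=
  ker_lift hk (proj1 (ker_incl_is_kernel p)).

Lemma ker_comparison_mono (p : Pt b) (x : C) (k : Hom x (pt_ob p))
    (hk : is_kernel k (pt_ret p)) : is_mono (ker_comparison hk).
Proof.
move=> z g h E; apply: (kernel_mono (ker_incl_is_kernel p)).
have <- := ker_liftE hk (proj1 (ker_incl_is_kernel p)).
by rewrite -!compA; congr (_ ∘ _).
Qed.

Definition ker_restriction (p : Pt b) (x : C) (k : Hom x (pt_ob p))
    (hk : is_kernel k (pt_ret p)) : functor (Sub p) (Sub x) :=
  induced_sub Ker_mono (@ker_comparison_mono p x k hk).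

End KernelFunctor.

Section SplitExtensionCores.
Variable C : category.

Record split_extension (b : C) : Type := SplitExtension {
  se_point :> point b;
  se_ker : C;
  se_incl : Hom se_ker (pt_ob se_point);
  se_is_kernel : is_kernel se_incl (pt_ret se_point)
}.

Section Liftings.
Variables (b : C) (E : split_extension b) (S : C) (s : Hom S (se_ker E)).

Record lifting : Type := Lifting {
  lft_ext :> split_extension b;
  lft_u : Hom (se_ker lft_ext) S;
  lft_v : Hom (pt_ob lft_ext) (pt_ob E);
  lft_incl : lft_v ∘ se_incl lft_ext = se_incl E ∘ s ∘ lft_u;
  lft_ret : pt_ret E ∘ lft_v = pt_ret lft_ext;
  lft_sec : lft_v ∘ pt_sec lft_ext = pt_sec E
}.

Record lifting_hom (L M : lifting) : Type := LiftingHom {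
  lh_ker : Hom (se_ker L) (se_ker M);
  lh_arr : Hom (pt_ob L) (pt_ob M);
  lh_incl : lh_arr ∘ se_incl L = se_incl M ∘ lh_ker;
  lh_ret : pt_ret M ∘ lh_arr = pt_ret L;
  lh_sec : lh_arr ∘ pt_sec L = pt_sec M;
  lh_u : lft_u M ∘ lh_ker = lft_u L;
  lh_v : lft_v M ∘ lh_arr = lft_v L
}.

Lemma lifting_hom_ext (L M : lifting) (f g : lifting_hom L M) :
  lh_ker f = lh_ker g -> lh_arr f = lh_arr g -> f = g.
Proof.
case: f g => f1 f2 ? ? ? ? ? [g1 g2 ? ? ? ? ?] /= E1 E2; subst g1 g2.
by f_equal; apply: proof_irrelevance.
Qed.

Definition lifting_id (L : lifting) : lifting_hom L L.
Proof.
by refine (@LiftingHom L L (idm _) (idm _) _ _ _ _ _);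
  rewrite ?comp_idl ?comp_idr.
Defined.

Definition lifting_comp (L M N : lifting) (g : lifting_hom M N)
    (f : lifting_hom L M) : lifting_hom L N.
Proof.
refine (@LiftingHom L N (lh_ker g ∘ lh_ker f) (lh_arr g ∘ lh_arr f) _ _ _ _ _).
- by rewrite compA -lh_incl -!compA lh_incl.
- by rewrite compA !lh_ret.
- by rewrite -compA !lh_sec.
- by rewrite compA !lh_u.
- by rewrite compA !lh_v.
Defined.

Definition lifting_category : category.
Proof.
refine (@Category lifting lifting_hom lifting_id lifting_comp _ _ _);
  move=> *; apply: lifting_hom_ext => /=;
  by [apply: comp_idl | apply: comp_idr | apply: compA].
Defined.

Definition is_split_extension_core (L : lifting) : Prop :=
  @is_terminal lifting_category L.

End Liftings.

Definition has_split_extension_cores : Prop :=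
  forall (b : C) (E : split_extension b) (S : C) (s : Hom S (se_ker E)),
    is_mono s -> exists L : lifting s, is_split_extension_core L.

End SplitExtensionCores.

(* Main.v *)
From Stdlib Require Import ssreflect ProofIrrelevance IndefiniteDescription.
Require Import Defs.

(** Subobject categories are thin, so a right adjoint of [F] amounts to a
    greatest subobject [v] of the point [(α, β)] among those whose restriction
    to kernels is contained in a given [s : S -> X].  A subobject [m] of
    [(α, β)] restricts into [s] exactly when [m], with any kernel of its domain,
    underlies a lifting of [s] ([restricts_intoP]).  So a right adjoint selects
    a terminal object among the liftings with monic [v]-component, while a core
    is terminal among all of them; the two differ by the liftings whose
    [v]-component is not monic.

    From cores to adjoints, the [v]-component of a core is automatically monic
    ([core_mono]): its kernel pair is again a lifting, and both projections are
    morphisms of liftings into the core, hence equal.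

    From adjoints to cores, every lifting of a regular category has an image
    ([lifting_image]).  If [v = m ∘ e] with [e] a regular epimorphism and [m]
    monic, the pullback of [e] along the kernel [j] of the image point is a
    regular epimorphism [r] with [m ∘ j ∘ r] factoring through the monomorphism
    [κ ∘ s]; as [r] is orthogonal to monomorphisms, so does [m ∘ j].  Thus [m]
    restricts into [s] and is below the greatest such subobject, which is
    therefore terminal among all liftings. *)

Set Implicit Arguments.
Unset Strict Implicit.
Unset Printing Implicit Defensive.

(** * Right adjoints between thin categories *)

Lemma preorder_right_adjointP (T T' : Type) (R : T -> T -> Prop)
    (R' : T' -> T' -> Prop) (r : forall x, R x x)
    (t : forall x y z, R y z -> R x y -> R x z) (r' : forall x, R' x x)
    (t' : forall x y z, R' y z -> R' x y -> R' x z)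
    (F : functor (preorder_category r t) (preorder_category r' t')) :
  has_right_adjoint F <->
  forall y : T', exists x : T, forall z : T, R' (F z) y <-> R z x.
Proof.
split=> [[G [A]] y|H].
  by exists (G y) => z; split; [exact: (@adj_to _ _ _ _ A z y)
                               | exact: (@adj_from _ _ _ _ A z y)].
pose g y := proj1_sig (constructive_indefinite_description _ (H y)).
have Hg y z : R' (F z) y <-> R z (g y).
  exact: (proj2_sig (constructive_indefinite_description _ (H y)) z).
have g_le y y' : R' y y' -> R (g y) (g y').
  by move=> le_yy'; apply/Hg; exact: (t' _ _ _ le_yy' (proj2 (Hg y (g y)) (r _))).
pose G := @Functor (preorder_category r' t') (preorder_category r t) g g_le
  (fun _ => proof_irrelevance (R _ _) _ _)
  (fun _ _ _ _ _ => proof_irrelevance (R _ _) _ _).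
exists G; constructor.
refine (@Adjunction _ _ F G (fun x y => proj1 (Hg y x))
  (fun x y => proj2 (Hg y x)) _ _ _ _) => *;
  by [exact: (proof_irrelevance (R' _ _)) | exact: (proof_irrelevance (R _ _))].
Qed.

Section SubobjectRepresentatives.
Variables (C : category) (d : C).

Definition subobject_of (m : mono_into d) : subobject d :=
  @Subobject C d (mono_equiv m)
    (ex_intro _ m (fun n => conj (fun h => h) (fun h => h))).

Lemma subobject_of_rep (m : mono_into d) : sub_rep (subobject_of m) m.
Proof. by split; apply: mono_le_refl. Qed.

Lemma subobject_has_rep (S : subobject d) : exists m, sub_rep S m.
Proof.
by case: (sub_is_class S) => m Hm; exists m; apply/Hm; split; apply: mono_le_refl.
Qed.

Lemma sub_leP (S T : subobject d) (m n : mono_into d) :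
  sub_rep S m -> sub_rep T n -> sub_le S T <-> mono_le m n.
Proof.
move=> Sm Tn; split=> [|le_mn m' n' Sm' Tn']; first exact.
have [_ le_m'm] := proj1 (sub_rep_equiv m' Sm) Sm'.
have [le_nn' _] := proj1 (sub_rep_equiv n' Tn) Tn'.
exact: mono_le_trans le_m'm (mono_le_trans le_mn le_nn').
Qed.

End SubobjectRepresentatives.

(** Replaces classes of monomorphisms by representatives: the value of the
    right adjoint at the class of [s] is the class of [v]. *)
Lemma induced_sub_right_adjointP (D C : category) (K : functor D C)
    (K_mono : forall (a b : D) (f : Hom a b), is_mono f -> is_mono (fmap K f))
    (d : D) (x : C) (i : Hom (K d) x) (i_mono : is_mono i) :
  has_right_adjoint (induced_sub K_mono i_mono) <->
  forall s : mono_into x, exists v : mono_into d, forall m : mono_into d,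
    mono_le (induced_mono K_mono i_mono m) s <-> mono_le m v.
Proof.
have rep T m : sub_rep T m ->
    sub_rep (induced_sub_ob K_mono i_mono T) (induced_mono K_mono i_mono m).
  by move=> Tm; exists m; split=> //; split; apply: mono_le_refl.
split=> [/preorder_right_adjointP H s|H].
  have [V HV] := H (subobject_of s).
  have [v Vv] := subobject_has_rep V; exists v => m.
  rewrite -(sub_leP (subobject_of_rep m) Vv) -HV.
  symmetry; apply: sub_leP; last exact: subobject_of_rep.
  by apply: rep; apply: subobject_of_rep.
apply/preorder_right_adjointP => S.
have [s Ss] := subobject_has_rep S; have [v Hv] := H s.
exists (subobject_of v) => T; have [m Tm] := subobject_has_rep T.
rewrite (sub_leP Tm (subobject_of_rep v)) -Hv.
by apply: sub_leP Ss; apply: rep.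
Qed.

(** * Regular epimorphisms and images *)

Lemma is_mono_comp (C : category) (a b c : C) (n : Hom b c) (m : Hom a b) :
  is_mono n -> is_mono m -> is_mono (n ∘ m).
Proof. by move=> Hn Hm z g h; rewrite -!compA => /Hn /Hm. Qed.

Lemma regular_epi_epi (C : category) (a b c : C) (q : Hom a b) (g h : Hom b c) :
  is_regular_epi q -> g ∘ q = h ∘ q -> g = h.
Proof.
case=> e [x [y [E U]]] Egh.
have Eg : g ∘ q ∘ x = g ∘ q ∘ y by rewrite -!compA E.
by case: (U _ _ Eg) => l [_ Ul]; rewrite -(Ul g) // (Ul h).
Qed.

(** Regular epimorphisms are left orthogonal to monomorphisms. *)
Lemma regular_epi_lift (C : category) (a b c d : C) (q : Hom a b)
    (n : Hom c d) (w : Hom a c) (y : Hom b d) :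
  is_regular_epi q -> is_mono n -> y ∘ q = n ∘ w -> exists t : Hom b c, n ∘ t = y.
Proof.
move=> Hq Hn Eyw; have [e [f [g [E U]]]] := Hq.
have Ew : w ∘ f = w ∘ g by apply: Hn; rewrite !compA -Eyw -!compA E.
have [t [Et _]] := U _ _ Ew; exists t.
by apply: (regular_epi_epi Hq); rewrite -compA Et.
Qed.

(** The factor [m] through the coequalizer of the kernel pair is monic because
    regular epimorphisms are stable under pullback. *)
Lemma regular_image (C : category) (a b : C) (f : Hom a b) :
  regular C ->
  exists (i : C) (e : Hom a i) (m : Hom i b),
    is_regular_epi e /\ is_mono m /\ m ∘ e = f.
Proof.
case=> hl [coeq stable].
have [P [p [q Hpq]]] := pullback_exists hl f f.
have [i [e He]] := coeq _ _ _ _ _ _ Hpq.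
have [Epq U] := Hpq; have [m [Em _]] := proj2 He _ _ Epq.
have e_reg : is_regular_epi e by exists P, p, q.
exists i, e, m; do !split=> //.
(* Covering [z] by regular epimorphisms, [g] and [h] lift along [e] to a pair
   of generalized elements of [a] identified by [f]. *)
move=> z g h Egh.
have [z1 [x1 [c1 H1]]] := pullback_exists hl e g.
have [z2 [x2 [c2 H2]]] := pullback_exists hl e (h ∘ c1).
apply: (regular_epi_epi (stable _ _ _ _ _ _ _ _ H1 e_reg)).
apply: (regular_epi_epi (stable _ _ _ _ _ _ _ _ H2 e_reg)).
have [E1 _] := H1; have [E2 _] := H2.
have Ef : f ∘ (x1 ∘ c2) = f ∘ x2.
  by rewrite -Em -!compA E2 (compA e) E1 !compA Egh.
have [l [[El1 El2] _]] := U _ _ _ Ef.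
by rewrite -E1 -E2 -(compA e) -El1 -El2 !compA (proj1 He).
Qed.

(** * Subobjects of points and liftings *)

Lemma point_mono_of_arr (C : category) (B : C) (p q : Pt B) (f : Hom p q) :
  is_mono (ph_arr f) -> is_mono f.
Proof.
move=> Hf z g h E; apply: point_hom_ext; apply: Hf.
exact: (f_equal (@ph_arr _ _ _ _) E).
Qed.

Section Restriction.
Variables (C : category) (hz : pointed C) (hl : finitely_complete C).

Lemma ker_comparisonE (B : C) (p : Pt B) (X : C) (k : Hom X (pt_ob p))
    (hk : is_kernel k (pt_ret p)) :
  k ∘ ker_comparison hz hl hk = ker_incl hz hl p.
Proof. exact: ker_liftE. Qed.

(** The right-hand side is the condition [lft_incl] of a lifting, for an
    arbitrary kernel [j]: it lets the chosen kernels of the kernel functor be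
    replaced by those that come with liftings. *)
Lemma restricts_intoP (B : C) (p : Pt B) (X : C) (k : Hom X (pt_ob p))
    (hk : is_kernel k (pt_ret p)) (s : mono_into X) (m : mono_into p)
    (Y : C) (j : Hom Y (pt_ob (mono_dom m)))
    (hj : is_kernel j (pt_ret (mono_dom m))) :
  mono_le (induced_mono (@Ker_mono C hz hl B)
             (@ker_comparison_mono C hz hl B p X k hk) m) s <->
  exists u : Hom Y (mono_dom s), ph_arr (mono_arr m) ∘ j = k ∘ mono_arr s ∘ u.
Proof.
have hi := ker_incl_is_kernel hz hl (mono_dom m).
have Em : k ∘ (ker_comparison hz hl hk ∘ fmap (Ker hz hl B) (mono_arr m))
    = ph_arr (mono_arr m) ∘ ker_incl hz hl (mono_dom m).
  by rewrite compA ker_comparisonE Ker_fmapE.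
split=> [[t /= Et]|[u Eu]].
  exists (t ∘ ker_lift hi (proj1 hj)).
  by rewrite compA -(compA k) Et Em -compA ker_liftE.
exists (u ∘ ker_lift hj (proj1 hi)) => /=.
apply: (kernel_mono hk).
by rewrite Em !compA -Eu -compA ker_liftE.
Qed.

Section Lifting.
Variables (B : C) (E : split_extension B) (S : C) (s : Hom S (se_ker E)).
Hypothesis s_mono : is_mono s.

Definition lifting_point_hom (L : lifting s) : @Hom (Pt B) L E :=
  @PointHom C B L E (lft_v L) (lft_ret L) (lft_sec L).

Lemma incl_mono : is_mono (se_incl E ∘ s).
Proof. by apply: is_mono_comp s_mono; apply: kernel_mono (se_is_kernel E). Qed.

(** If [p1] and [p2] form the kernel pair of [lft_v L], their common domain [P]
    is a point over [B].  The two candidates [lft_u L ∘ r1] and [lft_u L ∘ r2]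
    for the [u]-component of a lifting on [P] agree because both are determined
    by [lft_v L ∘ p1 = lft_v L ∘ p2].  Hence [p1] and [p2] are morphisms from
    one and the same lifting into the core. *)
Lemma core_mono (L : lifting s) : is_split_extension_core L -> is_mono (lft_v L).
Proof.
move=> HL z g h Egh.
have [P [p1 [p2 [E12 U]]]] := pullback_exists hl (lft_v L) (lft_v L).
have [c [[c1 c2] _]] := U _ (pt_sec L) (pt_sec L) (eq_refl _).
have Hc : pt_ret L ∘ p1 ∘ c = idm B by rewrite -compA c1 pt_eq.
have R2 : pt_ret L ∘ p2 = pt_ret L ∘ p1 by rewrite -(lft_ret L) -!compA E12.
have [[Y j hj] _] := kernel_exists hz hl (pt_ret L ∘ p1).
have Z1 : is_zero_arrow (pt_ret L ∘ (p1 ∘ j)) by rewrite compA; apply: (proj1 hj).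
have Z2 : is_zero_arrow (pt_ret L ∘ (p2 ∘ j)).
  by rewrite compA R2; apply: (proj1 hj).
pose r1 := ker_lift (se_is_kernel L) Z1.
pose r2 := ker_lift (se_is_kernel L) Z2.
have Er1 : se_incl L ∘ r1 = p1 ∘ j by apply: ker_liftE.
have Er2 : se_incl L ∘ r2 = p2 ∘ j by apply: ker_liftE.
have Eu1 : lft_v L ∘ p1 ∘ j = se_incl E ∘ s ∘ (lft_u L ∘ r1).
  by rewrite -compA -Er1 !compA lft_incl.
have Eu2 : lft_u L ∘ r2 = lft_u L ∘ r1.
  by apply: incl_mono; rewrite -Eu1 E12 compA -lft_incl -!compA Er2.
pose M : lifting s := @Lifting C B E S s
  (@SplitExtension C B (@Point C B P (pt_ret L ∘ p1) c Hc) Y j hj)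
  (lft_u L ∘ r1) (lft_v L ∘ p1) Eu1
  (eq_trans (compA _ _ _) (f_equal (fun f => f ∘ p1) (lft_ret L)))
  (eq_trans (eq_sym (compA _ _ _))
     (eq_trans (f_equal (fun f => lft_v L ∘ f) c1) (lft_sec L))).
pose f1 : lifting_hom M L := @LiftingHom C B E S s M L r1 p1
  (eq_sym Er1) (eq_refl _) c1 (eq_refl _) (eq_refl _).
pose f2 : lifting_hom M L := @LiftingHom C B E S s M L r2 p2
  (eq_sym Er2) R2 c2 Eu2 (eq_sym E12).
have [f0 Hf] := HL M.
have Ep : p1 = p2
  := f_equal (@lh_arr _ _ _ _ _ _ _) (eq_trans (Hf f1) (eq_sym (Hf f2))).
by have [l [[<- <-] _]] := U _ _ _ Egh; rewrite Ep.
Qed.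

(** Taking kernels preserves regular images of points: the pullback of the
    regular epimorphism [e] along [j] is a regular epimorphism onto the domain
    of [j], and its source maps into the kernel of [L], which [lft_u L] sends
    into [S]. *)
Lemma lifting_image (L : lifting s) : regular C ->
  exists (q : point B) (e : point_hom L q) (m : point_hom q E),
    is_mono (ph_arr m) /\ ph_arr m ∘ ph_arr e = lft_v L /\
    forall (Y : C) (j : Hom Y (pt_ob q)), is_kernel j (pt_ret q) ->
      exists u : Hom Y S, ph_arr m ∘ j = se_incl E ∘ s ∘ u.
Proof.
move=> reg; have [I [e [m [e_reg [m_mono Ev]]]]] := regular_image (lft_v L) reg.
have Hq : pt_ret E ∘ m ∘ (e ∘ pt_sec L) = idm B.
  by rewrite compA -(compA _ m) Ev -compA lft_sec pt_eq.
have He : pt_ret E ∘ m ∘ e = pt_ret L by rewrite -compA Ev lft_ret.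
have Hm : m ∘ (e ∘ pt_sec L) = pt_sec E by rewrite compA Ev lft_sec.
pose q := Point Hq.
exists q, (@PointHom C B L q e He (eq_refl _)), (@PointHom C B q E m (eq_refl _) Hm).
split=> //; split=> //= Y j hj.
have [P [x [r HP]]] := pullback_exists hl e j.
have r_reg := proj2 (proj2 reg) _ _ _ _ _ _ _ _ HP e_reg.
have [Exr _] := HP.
have Zx : is_zero_arrow (pt_ret L ∘ x).
  by rewrite -He -compA Exr compA; apply: zero_arrow_compr (proj1 hj).
have Emjr : m ∘ j ∘ r
    = se_incl E ∘ s ∘ (lft_u L ∘ ker_lift (se_is_kernel L) Zx).
  by rewrite compA -lft_incl -!compA ker_liftE -Ev -!compA Exr.
by have [u Eu] := regular_epi_lift r_reg incl_mono Emjr; exists u.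
Qed.

(** For monic [lft_v], terminality reduces to the existence of the middle
    component of a morphism: the kernel component is then forced and exists. *)
Lemma core_of_factorizations (L : lifting s) :
  is_mono (lft_v L) ->
  (forall M : lifting s, exists w : point_hom M L, lft_v L ∘ ph_arr w = lft_v M) ->
  is_split_extension_core L.
Proof.
move=> v_mono HL M; have [w Ew] := HL M.
have Zw : is_zero_arrow (pt_ret L ∘ (ph_arr w ∘ se_incl M)).
  by rewrite compA ph_ret; apply: (proj1 (se_is_kernel M)).
have Ek := ker_liftE (se_is_kernel L) Zw.
have Eu : lft_u L ∘ ker_lift (se_is_kernel L) Zw = lft_u M.
  by apply: incl_mono; rewrite compA -lft_incl -compA Ek compA Ew lft_incl.
exists (@LiftingHom C B E S s M L _ (ph_arr w) (eq_sym Ek) (ph_ret w) (ph_sec w)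
          Eu Ew) => f.
have Ef : lh_arr f = ph_arr w by apply: v_mono; rewrite lh_v Ew.
apply: lifting_hom_ext => //=.
by apply: (kernel_mono (se_is_kernel L)); rewrite -lh_incl Ek Ef.
Qed.

End Lifting.
End Restriction.

(** * Cores and right adjoints *)

Theorem proposition4p5 (C : category) (hz : pointed C) (hl : finitely_complete C) :
  (has_split_extension_cores C ->
     forall (B : C) (p : Pt B) (X : C) (k : Hom X (pt_ob p))
       (hk : is_kernel k (pt_ret p)),
       has_right_adjoint (ker_restriction hz hl hk)) /\
  (regular C ->
     (forall (B : C) (p : Pt B) (X : C) (k : Hom X (pt_ob p))
        (hk : is_kernel k (pt_ret p)),
        has_right_adjoint (ker_restriction hz hl hk)) ->
     has_split_extension_cores C).
Proof.
split=> [cores B p X k hk|reg adj B E S s s_mono].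
  apply/induced_sub_right_adjointP => s.
  pose E := SplitExtension hk.
  have [L HL] := cores B E _ _ (@mono_is_mono _ _ s).
  have v_mono : is_mono (lifting_point_hom L).
    by apply: point_mono_of_arr; apply: (core_mono hz hl _ HL); apply: mono_is_mono.
  exists (MonoInto v_mono) => m; split.
    have [[Y j hj] _] := kernel_exists hz hl (pt_ret (mono_dom m)).
    move/(restricts_intoP hz hl hk s hj) => [u Eu].
    have [f _] := HL (@Lifting C B E _ _ (SplitExtension hj) u
      (ph_arr (mono_arr m)) Eu (ph_ret (mono_arr m)) (ph_sec (mono_arr m))).
    exists (PointHom (lh_ret f) (lh_sec f)).
    by apply: point_hom_ext; apply: (lh_v f).
  move=> le_mv; apply: (mono_le_trans (induced_mono_le _ _ le_mv)).
  apply/(restricts_intoP hz hl hk s (m := MonoInto v_mono) (se_is_kernel L)).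
  by exists (lft_u L); apply: lft_incl.
have /induced_sub_right_adjointP /(_ (MonoInto s_mono)) [v Hv] :=
  adj B E (se_ker E) (se_incl E) (se_is_kernel E).
have [[Y j hj] _] := kernel_exists hz hl (pt_ret (mono_dom v)).
(* As a subobject below itself, [v] restricts into [s]; this is the lifting
   claimed to be the core. *)
have [u Eu] := proj1 (restricts_intoP hz hl _ _ hj)
  (proj2 (Hv v) (mono_le_refl v)).
exists (@Lifting C B E S s (SplitExtension hj) u (ph_arr (mono_arr v)) Eu
          (ph_ret (mono_arr v)) (ph_sec (mono_arr v))).
apply: core_of_factorizations => //=.
  exact: (point_mono hl (@mono_is_mono _ _ v)).
move=> M; have [q [e [m [m_mono [Em Hj]]]]] := lifting_image hl s_mono M reg.
have m_mono' : @is_mono (Pt B) q E m by apply: point_mono_of_arr.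
have [[Z i hi] _] := kernel_exists hz hl (pt_ret q).
have /Hv [w Ew] := proj2 (restricts_intoP hz hl (se_is_kernel E)
  (MonoInto s_mono) (m := MonoInto m_mono') hi) (Hj _ _ hi).
exists (point_comp w e) => /=.
by rewrite compA -Em; congr (_ ∘ _); apply: (f_equal (@ph_arr _ _ _ _) Ew).
Qed.
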